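(* Every SITAwIM $(A,\mathbf{B})$ of rank $5$ with standard basis of the form $\mathbf{B}=\{b_0,b_1,b_2,b_3,b_3^*\}$, where $b_1^*=b_1$, $b_2^*=b_2$ and $b_3^*\neq b_3$ (exactly one asymmetric pair; involution type $5A1$), has cyclotomic eigenvalues.
   Context: An integral table algebra $(A,\mathbf{B})$ is a finite-dimensional complex algebra $A$ with involution $*$ and a $*$-invariant basis $\mathbf{B}=\{b_0=1,\dots,b_{r-1}\}$ with nonnegative integer structure constants satisfying the pseudo-inverse condition (the coefficient of $1$ in $b_ib_j^*$ is positive iff $b_j=b_i^*$); elements of $\mathbf{B}$ are identified with their left regular matrices. It is standard if for each $b_i$ the coefficient of $1$ in $b_ib_i^*$ equals the maximal eigenvalue $\delta_i$ (degree) of $b_i$; this is a SITA of rank $r=|\mathbf{B}|$ and order $n=\sum_j\delta_j$. For commutative $A$ let $P=(\chi_i(b_j))$ be the character table, with $\chi_0(b_j)=\delta_j$; the multiplicity $m_i$ of $\chi_i$ is defined by $\sum_{j}|\chi_i(b_j)|^2/\delta_j=n/m_i$. A SITAwIM is a commutative SITA all of whose multiplicities $m_i$ are positive integers. ''Has cyclotomic eigenvalues'' means all eigenvalues of the regular matrices of the elements of $\mathbf{B}$ (equivalently all entries of $P$) lie in a cyclotomic extension of $\mathbb{Q}$.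
   Formalization: The pseudo-inverse condition is taken in its standard form, the coefficient of 1 in b_i b_j is positive iff b_j = b_i^*; with b_i b_j^* in place of b_i b_j, as worded, it contradicts standardness when b_3^* ≠ b_3. *)

(* Defs.v *)
From mathcomp Require Import all_boot all_order all_algebra all_field.
From mathcomp Require Import reals.
From mathcomp Require Import complex.

Set Implicit Arguments.
Unset Strict Implicit.
Unset Printing Implicit Defensive.

Import Order.TTheory GRing.Theory Num.Theory.
Local Open Scope ring_scope.

Section TableAlgebras.
Variables (C : numClosedFieldType) (A : falgType C).

(* An involution of a complex algebra is conjugate-linear.  With real structure
   constants this is equivalent to the linear convention: only the action of
   [star] on the distinguished basis matters. *)
Record algebra_involution (star : A -> A) : Prop := {
  starD : forall x y, star (x + y) = star x + star y;
  starZ : forall a x, star (a *: x) = a^* *: star x;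
  starM : forall x y, star (x * y) = star y * star x;
  starK : involutive star
}.

Section Basis.
Variables (r : nat) (star : A -> A) (B : r.+1.-tuple A).

Definition coef1 (x : A) : C := coord B ord0 x.

Record integral_table_algebra : Prop := {
  ita_involution : algebra_involution star;
  ita_basis : basis_of fullv B;
  ita_one : tnth B ord0 = 1;
  ita_star_closed : forall i, star (tnth B i) \in B;
  ita_nat : forall i j k,
    exists m : nat, coord B k (tnth B i * tnth B j) = m%:R;
  ita_pseudo_inverse : forall i j,
    0 < coef1 (tnth B i * tnth B j) <-> tnth B j = star (tnth B i)
}.

Definition regular_mx (i : 'I_r.+1) : 'M[C]_r.+1 :=
  \matrix_(k, j) coord B k (tnth B i * tnth B j).

(* The regular matrices are entrywise nonnegative, so by Perron-Frobenius the
   maximal eigenvalue is a nonnegative real that dominates every other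
   (possibly non-real) eigenvalue in modulus. *)
Definition maximal_eigenvalue n (M : 'M[C]_n) (d : C) : Prop :=
  eigenvalue M d /\ forall a, eigenvalue M a -> `|a| <= d.

Record SITA (delta : 'I_r.+1 -> C) : Prop := {
  sita_ita : integral_table_algebra;
  sita_degree : forall i, maximal_eigenvalue (regular_mx i) (delta i);
  sita_standard : forall i, coef1 (tnth B i * star (tnth B i)) = delta i
}.

Definition ita_order (delta : 'I_r.+1 -> C) : C := \sum_j delta j.

(* [A] being commutative over an algebraically closed field, its irreducible
   characters are its unital algebra morphisms to [C]. *)
Definition is_multiplicity (delta : 'I_r.+1 -> C)
    (chi : {lrmorphism A -> C | *%R}) (m : C) : Prop :=
  \sum_j `|chi (tnth B j)| ^+ 2 / delta j = ita_order delta / m.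

Definition SITAwIM : Prop :=
  exists delta : 'I_r.+1 -> C,
    [/\ SITA delta,
        commutative (@GRing.mul A)
      & forall chi : {lrmorphism A -> C | *%R},
          exists2 m : nat, (0 < m)%N & is_multiplicity delta chi m%:R].

End Basis.

(* Membership in the subfield Q(z) of [C]. *)
Definition in_Qadjoin (z a : C) : Prop :=
  exists p q : {poly rat},
    (map_poly ratr q).[z] != 0 /\
    a = (map_poly ratr p).[z] / (map_poly ratr q).[z].

Definition cyclotomic_eigenvalues r (B : r.+1.-tuple A) : Prop :=
  exists (N : nat) (z : C), N.-primitive_root z /\
    forall (i : 'I_r.+1) (a : C), eigenvalue (regular_mx B i) a -> in_Qadjoin z a.

End TableAlgebras.

(* Main.v *)
(* Put t = b3 - b3^*.  The elements with rational coordinates that star negates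
   are the rational multiples of t, so t x is a rational multiple of t for every
   rational symmetric x, and s = t^2 is rational and symmetric.  Let chi be a
   character.  If chi(t) <> 0, then chi is rational on rational symmetric
   elements, hence chi(t)^2 = chi(s) is rational and all the chi(b_i) lie in
   Q(chi(t)).  If chi(t) = 0, then either chi is the degree character, or chi
   vanishes on both s and J = \sum_j b_j; these are two independent rational
   relations among 1, chi(b1), chi(b2), chi(b3) = chi(b3^* ), so all the chi(b_i)
   are rational affine functions of x = chi(b1) or x = chi(b2), and expanding
   the square of that basis element shows that x is quadratic over Q.  Every
   eigenvalue is thus of the form u + sqrt v with u, v rational, and square
   roots of rationals are cyclotomic.

   That b_i J = delta_i J holds comes from Perron-Frobenius: for the form
   coef1 (x y^* ) the multiplication by b_i is normal, so replacing the
   coordinates of a delta_i-eigenvector by their absolute values gives a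
   nonnegative eigenvector.  Multiplying these over all i gives a common
   eigenvector x, and coef1 (x b_j^* ) computed in two ways shows that all the
   coordinates of x are equal. *)
From HB Require Import structures.
Require Import Defs.
From mathcomp Require Import all_boot all_order all_algebra all_field.
From mathcomp Require Import reals.
From mathcomp Require Import complex.
From mathcomp Require Import ring zify spectral cyclic.

Set Implicit Arguments.
Unset Strict Implicit.
Unset Printing Implicit Defensive.

Import Order.TTheory GRing.Theory Num.Theory.
Local Open Scope ring_scope.

(** * Roots of rational quadratics lie in cyclotomic fields *)

Section QuadraticCyclotomic.
Variable C : numClosedFieldType.
Implicit Types (z w x a b : C).

(** Dividing [X^n - 1] by [X - 1] leaves [1 + X + ... + X^(n-1)], whose value at 1 is [n]. *)
Lemma prod_1_sub_prim_root n z : n.-primitive_root z ->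
  \prod_(1 <= k < n) (1 - z ^+ k) = n%:R.
Proof.
move=> prim_z; have n_gt0 := prim_order_gt0 prim_z.
have := factor_Xn_sub_1 prim_z; rewrite big_ltn // expr0.
rewrite -[in RHS](expr1n _ n) subrXX => /mulfI.
rewrite polyXsubC_eq0 => /(_ isT) /(congr1 (horner^~ 1)).
rewrite horner_prod horner_sum.
under eq_bigr do rewrite !hornerE; move=> ->.
under eq_bigr do rewrite expr1n mulr1 !hornerE expr1n.
by rewrite sumr_const card_ord.
Qed.

Lemma prim_root_half n z : (2 * n).-primitive_root z -> z ^+ n = -1.
Proof.
move=> prim_z; have n_gt0 : (0 < n)%N by have := prim_order_gt0 prim_z; lia.
have : (z ^+ n - 1) * (z ^+ n + 1) = 0.
  by rewrite -subr_sqr expr1n -exprM mulnC prim_expr_order // subrr.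
move=> /eqP; rewrite mulf_eq0 subr_eq0 -(prim_order_dvd prim_z) addr_eq0.
by case/orP => [/dvdn_leq|/eqP//]; lia.
Qed.

(* Pairing [k] with [2m - k] in the product of the [1 - zeta ^ k] over a
   primitive [2m]-th root [zeta = w ^ 2] writes [m] as a square, because
   [- zeta ^ (- k)] is the square of [w ^ (m - k)]. *)
Lemma sqr_prod_prim_root m w : (4 * m).-primitive_root w ->
  (\prod_(1 <= k < m) (w ^+ (m - k) * (1 - w ^+ (2 * k)))) ^+ 2 = m%:R.
Proof.
move=> prim_w; have m_gt0 : (0 < m)%N by have := prim_order_gt0 prim_w; lia.
have w4 : w ^+ (4 * m) = 1 by exact: prim_expr_order.
have w2 : w ^+ (2 * m) = -1 by apply: prim_root_half; rewrite mulnA.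
have w_neq0 : w != 0.
  by apply: contra_eq_neq w4 => ->; rewrite expr0n muln_eq0 /= eqn0Ngt m_gt0 eq_sym oner_eq0.
have prim_z : (m + m).-primitive_root (w ^+ 2).
  have -> : (m + m = (4 * m) %/ gcdn 2 (4 * m))%N.
    by rewrite (gcdn_idPl _) ?dvdn_mulr // (_ : 4 * m = (m + m) * 2)%N ?mulnK //; lia.
  exact: exp_prim_root.
have := prod_1_sub_prim_root prim_z.
rewrite (big_cat_nat (n := m)) ?leq_addr //=.
(* The middle factor [k = m] is 1 - (-1) = 2 and cancels the 2 of [2m]. *)
rewrite [X in _ * X]big_ltn; last by lia.
rewrite -exprM w2 (_ : 1 - -1 = 2 :> C); last by ring.
rewrite [\prod_(m.+1 <= _ < _) _]big_nat_rev /= -(add1n m) big_addn addnK.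
rewrite mulrCA -big_split /= addnn -mul2n natrM => /mulfI.
rewrite pnatr_eq0 => /(_ isT) <-; rewrite expr2 -big_split /=.
apply: eq_big_nat => k /andP[k_gt0 k_ltm].
have -> : (1 + m + 2 * m - (k + m).+1 = m + m - k)%N by lia.
have wk : w ^+ (2 * (m + m - k)) * w ^+ (2 * k) = 1.
  by rewrite -exprD -w4; congr (_ ^+ _); lia.
have wmk : w ^+ (m - k) * w ^+ (m - k) * w ^+ (2 * k) = -1.
  by rewrite -!exprD -w2; congr (_ ^+ _); lia.
rewrite -!exprM; move: wk wmk.
set u := w ^+ (2 * k); set v := w ^+ (2 * _); set s := w ^+ _ => vu su.
transitivity (1 - u - v + v * u); last by ring.
transitivity (s * s * u * (u - 2) + s * s); first by ring.
rewrite su vu; have -> : s * s = - v; last by ring.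
have u_neq0 : u != 0 by rewrite expf_neq0.
by apply: (mulIf u_neq0); rewrite su mulNr vu.
Qed.

Lemma closed_prim_root_exists n : (0 < n)%N -> exists z, n.-primitive_root z.
Proof.
move=> n_gt0; pose p : {poly C} := 'X^n - 1.
have [r Dp] := closed_field_poly_normal p.
rewrite (monicP _) ?monicXnsubC // scale1r in Dp.
have rn1 : all n.-unity_root r by apply/allP=> z; rewrite -root_prod_XsubC -Dp.
have sz_r : (n < (size r).+1)%N.
  by rewrite -(size_prod_XsubC r id) -Dp size_XnsubC.
have [|z] := hasP (has_prim_root n_gt0 rn1 _ sz_r); last by exists z.
by rewrite -separable_prod_XsubC -Dp separable_Xn_sub_1 // pnatr_eq0 -lt0n.
Qed.

Definition is_rat x := exists q : rat, x = ratr q.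

Lemma is_rat_nat n : is_rat n%:R.
Proof. by exists n%:R; rewrite ratr_nat. Qed.

Lemma is_ratD x y : is_rat x -> is_rat y -> is_rat (x + y).
Proof. by move=> [p ->] [q ->]; exists (p + q); rewrite rmorphD. Qed.

Lemma is_ratN x : is_rat x -> is_rat (- x).
Proof. by move=> [p ->]; exists (- p); rewrite rmorphN. Qed.

Lemma is_ratB x y : is_rat x -> is_rat y -> is_rat (x - y).
Proof. by move=> rx ry; apply/is_ratD/is_ratN. Qed.

Lemma is_ratM x y : is_rat x -> is_rat y -> is_rat (x * y).
Proof. by move=> [p ->] [q ->]; exists (p * q); rewrite rmorphM. Qed.

Lemma is_ratV x : is_rat x -> is_rat x^-1.
Proof. by move=> [p ->]; exists p^-1; rewrite fmorphV. Qed.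

Lemma is_rat_sum (I : finType) (F : I -> C) :
  (forall i, is_rat (F i)) -> is_rat (\sum_i F i).
Proof.
move=> ratF; apply: (big_ind is_rat) => //; [exact: (is_rat_nat 0)|exact: is_ratD].
Qed.

Lemma is_rat_conj x : is_rat x -> x^* = x.
Proof. by move=> [q ->]; rewrite fmorph_div /= !rmorph_int. Qed.

Lemma in_Qadjoin_rat z x : is_rat x -> in_Qadjoin z x.
Proof.
move=> [q ->]; exists q%:P, 1.
by rewrite rmorph1 map_polyC !hornerE oner_eq0 invr1 mulr1.
Qed.

Lemma in_Qadjoin_gen z : in_Qadjoin z z.
Proof.
by exists 'X, 1; rewrite rmorph1 map_polyX !hornerE oner_eq0 invr1 mulr1.
Qed.

Lemma in_QadjoinD z x y : in_Qadjoin z x -> in_Qadjoin z y -> in_Qadjoin z (x + y).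
Proof.
move=> [p1 [q1 [q1z ->]]] [p2 [q2 [q2z ->]]].
exists (p1 * q2 + p2 * q1), (q1 * q2).
by rewrite rmorphD !rmorphM hornerD !hornerM mulf_neq0 // addf_div.
Qed.

Lemma in_QadjoinM z x y : in_Qadjoin z x -> in_Qadjoin z y -> in_Qadjoin z (x * y).
Proof.
move=> [p1 [q1 [q1z ->]]] [p2 [q2 [q2z ->]]]; exists (p1 * p2), (q1 * q2).
by rewrite !rmorphM !hornerM mulf_neq0 // mulf_div.
Qed.

Lemma in_QadjoinX z x n : in_Qadjoin z x -> in_Qadjoin z (x ^+ n).
Proof.
move=> zx; elim: n => [|n IHn]; first exact/in_Qadjoin_rat/(is_rat_nat 1).
by rewrite exprS; apply: in_QadjoinM.
Qed.

Lemma in_QadjoinB z x y : in_Qadjoin z x -> in_Qadjoin z y -> in_Qadjoin z (x - y).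
Proof.
move=> zx zy; apply: in_QadjoinD => //; rewrite -mulN1r; apply: in_QadjoinM => //.
by apply: in_Qadjoin_rat; exists (-1); rewrite rmorphN1.
Qed.

Lemma in_Qadjoin_prod z (I : Type) (r : seq I) (P : pred I) (F : I -> C) :
  (forall i, in_Qadjoin z (F i)) -> in_Qadjoin z (\prod_(i <- r | P i) F i).
Proof.
move=> zF; apply: (big_ind (in_Qadjoin z)) => //; last exact: in_QadjoinM.
exact/in_Qadjoin_rat/(is_rat_nat 1).
Qed.

(* Quantifying over all the multiples of [m] lets finitely many elements be
   put in a common cyclotomic field. *)
Definition eventually_cyclotomic x := exists2 m : nat, (0 < m)%N &
  forall N z, (m %| N)%N -> N.-primitive_root z -> in_Qadjoin z x.

(** For [m = |d|] nonzero, a primitive [4m]-th root yields a square root of [m], and its [m]-th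
    power is a square root of -1. This gives a square root of [d], equal to [x] up to sign. *)
Lemma sqrt_int_eventually_cyclotomic (d : int) x :
  x ^+ 2 = d%:~R -> eventually_cyclotomic x.
Proof.
have [-> /eqP|d_neq0 x2] := eqVneq d 0.
  rewrite expf_eq0 /= => /eqP->; exists 1%N => // N z _ _.
  exact/in_Qadjoin_rat/(is_rat_nat 0).
have m_gt0 : (0 < `|d|)%N by rewrite absz_gt0.
set m := `|d|%N in m_gt0; exists (4 * m)%N => [|N z dvN prim_z]; first by lia.
have [k DN] := dvdnP dvN; pose w := z ^+ k.
have zw : in_Qadjoin z w by exact/in_QadjoinX/in_Qadjoin_gen.
have N_gt0 := prim_order_gt0 prim_z.
have prim_w : (4 * m).-primitive_root w.
  have -> : (4 * m = N %/ gcdn k N)%N.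
    rewrite (gcdn_idPl _) DN ?dvdn_mulr // mulKn //; lia.
  exact: exp_prim_root.
have := sqr_prod_prim_root prim_w; set s := \prod_(_ <= _ < _) _ => s2.
have zs : in_Qadjoin z s.
  apply: in_Qadjoin_prod => j; apply: in_QadjoinM; first exact: in_QadjoinX.
  apply: in_QadjoinB; [exact/in_Qadjoin_rat/(is_rat_nat 1)|exact: in_QadjoinX].
have [y zy y2] : exists2 y, in_Qadjoin z y & y ^+ 2 = d%:~R.
  have [d_ge0|d_lt0] := leP 0 d; first by exists s; rewrite // s2 pmulrn gez0_abs.
  exists (w ^+ m * s); first by apply: in_QadjoinM => //; apply: in_QadjoinX.
  rewrite exprMn s2 -exprM mulnC (prim_root_half (n := 2 * m)) ?mulnA //.
  by rewrite pmulrn ltz0_abs // rmorphN mulN1r opprK.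
have : (x - y) * (x + y) = 0 by rewrite -subr_sqr x2 y2 subrr.
move=> /eqP; rewrite mulf_eq0 subr_eq0 addr_eq0 => /orP[|] /eqP -> //.
by rewrite -sub0r; apply: in_QadjoinB => //; exact/in_Qadjoin_rat/(is_rat_nat 0).
Qed.

Definition rat_quadratic x :=
  exists u v, [/\ is_rat u, is_rat v & x ^+ 2 = u * x + v].

Lemma rat_quadratic_rat x : is_rat x -> rat_quadratic x.
Proof.
by move=> rx; exists x, 0; split=> //; [exact: (is_rat_nat 0)|rewrite addr0].
Qed.

Lemma rat_quadratic_affine c e x :
  is_rat c -> is_rat e -> rat_quadratic x -> rat_quadratic (c + e * x).
Proof.
move=> rc re [u [v [ru rv x2]]].
(* Trace and minus norm of [c + e * x], when [x] has trace [u] and norm [- v]; the formula stays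
   valid for [e = 0]. *)
exists (2 * c + e * u), (e ^+ 2 * v - c ^+ 2 - c * e * u); split.
- by apply: is_ratD; apply: is_ratM => //; exact: (is_rat_nat 2).
- by apply: is_ratB; [apply: is_ratB|]; do ?[apply: is_ratM => //].
- transitivity (c ^+ 2 + 2 * c * e * x + e ^+ 2 * x ^+ 2); first by ring.
  by rewrite x2; ring.
Qed.

(** Completing the square: [2 * x - u] has a rational square [q], and scaling it by [denq q] makes
    the square the integer [numq q * denq q]. *)
Lemma rat_quadratic_eventually_cyclotomic x :
  rat_quadratic x -> eventually_cyclotomic x.
Proof.
move=> [u [v [ru rv x2]]]; pose y := 2 * x - u.
have [q y2] : is_rat (y ^+ 2).
  have -> : y ^+ 2 = u * u + 4 * v by rewrite /y; ring: x2.
  by apply: is_ratD; apply: is_ratM => //; exact: (is_rat_nat 4).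
have [|m m_gt0 mP] := @sqrt_int_eventually_cyclotomic (numq q * denq q) (y * (denq q)%:~R).
  rewrite exprMn y2 rmorphM /= expr2 mulrA.
  by rewrite -(ratr_int _ (numq q)) numqE rmorphM /= ratr_int.
exists m => // N z mN prim_z; have zy := mP N z mN prim_z.
have -> : x = (u + y * (denq q)%:~R * ((denq q)%:~R)^-1) * 2^-1.
  have dq : (denq q)%:~R != 0 :> C by rewrite intr_eq0 denq_neq0.
  by rewrite /y; field.
apply: in_QadjoinM; last by apply/in_Qadjoin_rat/is_ratV/(is_rat_nat 2).
apply: in_QadjoinD; first exact: in_Qadjoin_rat.
apply: in_QadjoinM => //; apply/in_Qadjoin_rat/is_ratV.
by exists (denq q)%:~R; rewrite ratr_int.
Qed.

Definition rat_affine x y := exists c e, [/\ is_rat c, is_rat e & y = c + e * x].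

Lemma rat_affine_gen x : rat_affine x x.
Proof.
exists 0, 1; split; [exact: (is_rat_nat 0)|exact: (is_rat_nat 1)|].
by rewrite mul1r add0r.
Qed.

Lemma rat_affine_rat x y : is_rat y -> rat_affine x y.
Proof.
by move=> ry; exists y, 0; split=> //; [exact: (is_rat_nat 0)|rewrite mul0r addr0].
Qed.

Lemma rat_affineD x y z : rat_affine x y -> rat_affine x z -> rat_affine x (y + z).
Proof.
move=> [c [e [rc re ->]]] [c' [e' [rc' re' ->]]].
by exists (c + c'), (e + e'); split; [exact: is_ratD|exact: is_ratD|ring].
Qed.

Lemma rat_affineZ x q y : is_rat q -> rat_affine x y -> rat_affine x (q * y).
Proof.
move=> rq [c [e [rc re ->]]].
by exists (q * c), (q * e); split; [exact: is_ratM|exact: is_ratM|ring].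
Qed.

Lemma rat_affine_relation p u v x y : is_rat p -> is_rat u -> is_rat v -> v != 0 ->
  p + u * x + v * y = 0 -> rat_affine x y.
Proof.
move=> rp ru rv v_neq0 /eqP; rewrite addr_eq0 => /eqP Dy.
exists (- (p / v)), (- (u / v)); split.
- by apply/is_ratN/is_ratM => //; apply: is_ratV.
- by apply/is_ratN/is_ratM => //; apply: is_ratV.
apply: (mulfI v_neq0); rewrite -[LHS]opprK -Dy; field; exact: v_neq0.
Qed.

Lemma rat_quadratic_rat_affine x y :
  rat_affine x (x ^+ 2) -> rat_affine x y -> rat_quadratic y.
Proof.
move=> [v [u [rv ru x2]]] [c [e [rc re ->]]]; apply: rat_quadratic_affine => //.
by exists u, v; split=> //; rewrite addrC.
Qed.

Lemma seq_eventually_cyclotomic (s : seq C) :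
  (forall x, x \in s -> eventually_cyclotomic x) ->
  exists (N : nat) z, N.-primitive_root z /\ forall x, x \in s -> in_Qadjoin z x.
Proof.
move=> sP.
suff [m m_gt0 mP] : exists2 m : nat, (0 < m)%N & forall N z, (m %| N)%N ->
    N.-primitive_root z -> forall x, x \in s -> in_Qadjoin z x.
  have [z prim_z] := closed_prim_root_exists m_gt0.
  by exists m, z; split=> //; apply: mP prim_z.
elim: s sP => [|y s IHs] sP; first by exists 1%N.
have [|m m_gt0 mP] := IHs; first by move=> x xs; apply: sP; rewrite in_cons xs orbT.
have [n n_gt0 nP] := sP y (mem_head _ _).
exists (m * n)%N => [|N z mnN prim_z x]; first by rewrite muln_gt0 m_gt0.
rewrite in_cons => /orP[/eqP->|].
  by apply: (nP N) => //; apply: dvdn_trans mnN; rewrite dvdn_mull.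
by apply: (mP N) => //; apply: dvdn_trans mnN; rewrite dvdn_mulr.
Qed.

End QuadraticCyclotomic.

(** * A dominance criterion for eigenvectors of normal matrices *)

Section NormalDominant.
Local Open Scope sesquilinear_scope.
Variables (C : numClosedFieldType) (n : nat).

(** In an orthonormal eigenbasis, with eigenvalues [s_j] and coordinates [y_j] of [u], the last
    hypothesis bounds the sum of the [(d - s_j) |y_j|^2] by 0. Since [|s_j| <= d], the real parts of
    its terms are nonnegative, so they vanish; hence [s_j = d] wherever [y_j] is nonzero. *)
Lemma normal_dominant_eigenvector (M : 'M[C]_n) d (u : 'rV[C]_n) :
    M \is normalmx -> (forall a, eigenvalue M a -> `|a| <= d) ->
    d * (u *m u ^t*) 0 0 <= (u *m M *m u ^t*) 0 0 ->
  u *m M = d *: u.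
Proof.
move=> /orthomx_spectralP; set P := spectralmx M; set s := spectral_diag M => DM dmax.
have uP : P \is unitarymx := spectral_unitarymx M.
have unitP : P \in unitmx := spectral_unit M.
have s_le k : `|s 0 k| <= d.
  apply: dmax; apply/eigenvalueP; exists (row k P).
    rewrite {1}DM -row_mul !mulmxA mulmxV // mul1mx row_mul row_diag_mx.
    by rewrite -scalemxAl -rowE.
  by apply/eqP => Pk0; move: unitP; rewrite -row_free_unit => /row_freeP[Q /(congr1 (row k))];
    rewrite row_mul Pk0 mul0mx row1 => /rowP/(_ k); rewrite !mxE !eqxx => /esym/eqP;
    rewrite oner_eq0.
pose y := u *m P ^t*.
have Du : u = y *m P by rewrite /y -invmx_unitary // mulmxKV.
have DuM : u *m M = y *m diag_mx s *m P.
  by rewrite DM {1}Du !mulmxA mulmxK.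
clearbody y.
have PP : P *m P ^t* = 1%:M by apply/unitarymxP.
have -> : u *m u ^t* = y *m y ^t*.
  by rewrite {1 2}Du trmx_mul map_mxM mulmxA -(mulmxA y) PP mulmx1.
have -> : u *m M *m u ^t* = y *m diag_mx s *m y ^t*.
  by rewrite DuM {1}Du trmx_mul map_mxM mulmxA -(mulmxA _ P) PP mulmx1.
move=> le_dy; suff Dy : y *m diag_mx s = d *: y by rewrite DuM Dy -scalemxAl -Du.
(* Only an actual eigenvalue forces [d] to be nonnegative; for [n = 0] the rows are empty. *)
have [k _|n0] := pickP 'I_n; last by apply/rowP => k; have := n0 k.
have d_ge0 : 0 <= d := le_trans (normr_ge0 _) (s_le k).
have d_real : d \is Num.real by exact: ger0_real.
have term_ge0 j : 0 <= 'Re (d - s 0 j) * `|y 0 j| ^+ 2.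
  rewrite mulr_ge0 ?exprn_ge0 // raddfB /= (Creal_ReP _ d_real) subr_ge0.
  apply: le_trans (s_le j); apply: le_trans (real_ler_norm (Creal_Re _)) _.
  exact: (leif_normC_Re_Creal (s 0 j)).
have sum_eq0 : \sum_j 'Re (d - s 0 j) * `|y 0 j| ^+ 2 = 0.
  apply/eqP; rewrite eq_le sumr_ge0 ?andbT //.
  have Dsum : \sum_j (d - s 0 j) * `|y 0 j| ^+ 2 <= 0.
    rewrite -subr_le0 in le_dy; apply: le_trans le_dy.
    rewrite le_eqVlt; apply/orP; left; apply/eqP.
    rewrite !mxE mulr_sumr -sumrB; apply: eq_bigr => j _.
    rewrite mul_mx_diag !mxE normCK; ring.
  have <- : 'Re (\sum_j (d - s 0 j) * `|y 0 j| ^+ 2)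
      = \sum_j 'Re (d - s 0 j) * `|y 0 j| ^+ 2.
    rewrite raddf_sum; apply: eq_bigr => j _ /=.
    by rewrite ReMr // realX ?normr_real.
  by rewrite (Creal_ReP _ (ler0_real Dsum)).
have {}sum_eq0 j : 'Re (d - s 0 j) * `|y 0 j| ^+ 2 = 0.
  by apply: (psumr_eq0P _ sum_eq0).
apply/rowP => j; rewrite mul_mx_diag !mxE mulrC.
have /eqP := sum_eq0 j; rewrite mulf_eq0 expf_eq0 normr_eq0 /=.
case/orP => [|/eqP->]; last by rewrite !mulr0.
rewrite raddfB /= (Creal_ReP _ d_real) subr_eq0 => /eqP Dd.
(* The real part of [s 0 j] is [d], which bounds its modulus, so [s 0 j] is real. *)
have s_real : s 0 j \is Num.real.
  rewrite -(leif_normC_Re_Creal (s 0 j)) eq_le (leif_normC_Re_Creal (s 0 j)).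
  by rewrite -Dd (ger0_norm d_ge0) s_le.
by rewrite Dd (Creal_ReP _ s_real).
Qed.

End NormalDominant.

(** * Commutative standard table algebras: degrees, characters, rationality *)

Section CommutativeSITA.
Variables (C : numClosedFieldType) (A : falgType C) (r : nat) (star : A -> A).
Variables (B : r.+1.-tuple A) (delta : 'I_r.+1 -> C).
Hypotheses (sitaB : SITA star B delta) (mulC : commutative (@GRing.mul A)).
Local Notation b := (tnth B).
Local Notation coef := (coord B).
Local Notation coef1 := (Defs.coef1 B).

Let itaB : integral_table_algebra star B := sita_ita sitaB.
Let invB : algebra_involution star := ita_involution itaB.

Lemma coord_decomp x : x = \sum_j coef j x *: b j.
Proof.
rewrite {1}(coord_basis (ita_basis itaB) (memvf x)).
by apply: eq_bigr => j _; rewrite (tnth_nth 0).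
Qed.

Lemma coord_tnth j k : coef k (b j) = (j == k)%:R.
Proof. by rewrite (tnth_nth 0) coord_free // (basis_free (ita_basis itaB)). Qed.

Lemma coord_ext x y : (forall k, coef k x = coef k y) -> x = y.
Proof.
by move=> xy; rewrite (coord_decomp x) (coord_decomp y); apply: eq_bigr => k _; rewrite xy.
Qed.

Lemma coord_lincomb (c : 'I_r.+1 -> C) k : coef k (\sum_j c j *: b j) = c k.
Proof.
rewrite linear_sum (bigD1 k) //= big1 ?addr0 => [|j jk].
  by rewrite linearZ /= coord_tnth eqxx mulr1.
by rewrite linearZ /= coord_tnth (negPf jk) mulr0.
Qed.

Lemma tnth_basis_inj : injective b.
Proof.
move=> i j /(congr1 (coef j)); rewrite !coord_tnth eqxx.
by case: eqP => // _ /eqP; rewrite eq_sym oner_eq0.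
Qed.

(** The default [ord0] is never reached, as the basis is closed under [star]. *)
Definition dual i := odflt ord0 [pick k | b k == star (b i)].

Lemma tnth_dual i : b (dual i) = star (b i).
Proof.
rewrite /dual; case: pickP => [k /eqP //|noB].
have /tnthP[k Dk] := ita_star_closed itaB i.
by have := noB k; rewrite -Dk eqxx.
Qed.

Lemma dualK : involutive dual.
Proof. by move=> i; apply: tnth_basis_inj; rewrite !tnth_dual (starK invB). Qed.

Lemma star0 : star 0 = 0.
Proof. by apply: (addIr (star 0)); rewrite -(starD invB) !add0r. Qed.

Lemma star_decomp x : star x = \sum_j (coef j x)^* *: star (b j).
Proof.
rewrite {1}(coord_decomp x) (big_morph star (starD invB) star0).
by apply: eq_bigr => j _; rewrite (starZ invB).
Qed.

Lemma starN x : star (- x) = - star x.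
Proof. by rewrite -scaleN1r (starZ invB) rmorphN1 scaleN1r. Qed.

Lemma starB x y : star (x - y) = star x - star y.
Proof. by rewrite (starD invB) starN. Qed.

Lemma star1 : star 1 = 1.
Proof. by rewrite -[LHS]mulr1 -{2}(starK invB 1) -(starM invB) mulr1 (starK invB). Qed.

Lemma coord_mul_ge0 i j k : 0 <= coef k (b i * b j).
Proof. by have [n ->] := ita_nat itaB i j k; rewrite ler0n. Qed.

(** By the pseudo-inverse condition only the [b k] term of [x] contributes, and standardness
    evaluates it. Thus the basis is orthogonal for the form [coef1 (x * star y)], with squared norms
    [delta k]. *)
Lemma coef1_star_tnth x k : coef1 (x * star (b k)) = coef k x * delta k.
Proof.
rewrite {1}(coord_decomp x) mulr_suml /Defs.coef1 linear_sum (bigD1 k) //= big1 ?addr0.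
  by rewrite -scalerAl linearZ /= -(sita_standard sitaB).
move=> j jk; rewrite -scalerAl linearZ /= -tnth_dual.
have [n Dn] := ita_nat itaB j (dual k) ord0.
have [] := ita_pseudo_inverse itaB j (dual k); rewrite /Defs.coef1 Dn tnth_dual.
rewrite ltr0n => n_gt0 _; case: n {Dn} n_gt0 => [|n] n_gt0; first by rewrite mulr0.
have /(can_inj (starK invB))/tnth_basis_inj Dj := n_gt0 isT.
by rewrite Dj eqxx in jk.
Qed.

Lemma degree_gt0 i : 0 < delta i.
Proof.
rewrite -(sita_standard sitaB) -tnth_dual.
by apply/(ita_pseudo_inverse itaB); rewrite tnth_dual.
Qed.

Lemma degree_neq0 i : delta i != 0.
Proof. exact/lt0r_neq0/degree_gt0. Qed.

Lemma degree_nat i : exists n : nat, delta i = n%:R.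
Proof.
have [n Dn] := ita_nat itaB i (dual i) ord0.
by exists n; rewrite -Dn tnth_dual -(sita_standard sitaB).
Qed.

Lemma degree_dual i : delta (dual i) = delta i.
Proof. by rewrite -!(sita_standard sitaB) tnth_dual (starK invB) mulC. Qed.

Lemma degree_ord0 : delta ord0 = 1.
Proof.
rewrite -(sita_standard sitaB) (ita_one itaB) star1 mulr1 -(ita_one itaB).
by rewrite /Defs.coef1 coord_tnth eqxx.
Qed.

Lemma coef1_star x : coef1 (star x) = (coef1 x)^*.
Proof.
have coef1_tnth j : coef ord0 (star (b j)) = (j == ord0)%:R.
  rewrite -[LHS]/(coef1 _) -[star _]mul1r coef1_star_tnth -(ita_one itaB) coord_tnth eq_sym.
  by case: eqP => [->|]; rewrite ?mul0r // degree_ord0 mulr1.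
rewrite star_decomp /Defs.coef1 linear_sum (bigD1 ord0) //= big1 ?addr0 => [|j jk].
  by rewrite linearZ /= coef1_tnth mulr1.
by rewrite linearZ /= coef1_tnth (negPf jk) mulr0.
Qed.

(** Multiplications by [b i] and [star (b i)] are adjoint for the form: the sides are [coef1] of two
    elements exchanged by [star], hence conjugate, and they are natural numbers. *)
Lemma coord_mul_adjoint i j k :
  coef k (b i * b j) * delta k = coef j (b (dual i) * b k) * delta j.
Proof.
have [n Dn] := ita_nat itaB i j k; have [d Dd] := degree_nat k.
rewrite -[RHS]coef1_star_tnth -[LHS]conjCK.
have -> : (coef k (b i * b j) * delta k)^* = coef k (b i * b j) * delta k.
  by rewrite Dn Dd -natrM conjC_nat.
rewrite -coef1_star_tnth -coef1_star !(starM invB) (starK invB) tnth_dual.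
by rewrite mulC -mulrA mulC.
Qed.

Lemma coord_mul i x k : coef k (b i * x) = \sum_j coef j x * coef k (b i * b j).
Proof.
rewrite {1}(coord_decomp x) mulr_sumr linear_sum; apply: eq_bigr => j _.
by rewrite -scalerAr linearZ.
Qed.

(** [eigenvalue] refers to row vectors, on which [regular_mx] acts as the transpose of the
    multiplication. Rescaling coordinates by [delta] turns this transpose into the adjoint, which
    explains the dual index. *)
Lemma eigenvalue_regular_dual i a :
  eigenvalue (regular_mx B (dual i)) a <-> exists2 x, x != 0 & b i * x = a *: x.
Proof.
split=> [/eigenvalueP[v va v_neq0]|[x x_neq0 xa]].
  exists (\sum_k (v 0 k / delta k) *: b k).
    apply: contraNneq v_neq0 => x0; apply/eqP/rowP => k; rewrite mxE.
    have := congr1 (coef k) x0; rewrite coord_lincomb linear0 => /eqP.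
    by rewrite mulf_eq0 invr_eq0 (negPf (degree_neq0 k)) orbF => /eqP.
  apply: coord_ext => j; rewrite coord_mul linearZ /= coord_lincomb.
  under eq_bigr do rewrite coord_lincomb.
  apply: (mulIf (degree_neq0 j)); rewrite mulrA divfK ?degree_neq0 // mulr_suml.
  have /rowP/(_ j) := va; rewrite !mxE => <-; apply: eq_bigr => k _.
  rewrite mxE -mulrA coord_mul_adjoint mulrA mulrAC.
  by rewrite mulrC -!mulrA mulVf ?degree_neq0 // mulr1 mulrC.
apply/eigenvalueP; exists (\row_k (coef k x * delta k)); last first.
  apply: contraNneq x_neq0 => v0; apply/eqP/coord_ext => k; rewrite linear0.
  have /rowP/(_ k) := v0; rewrite !mxE => /eqP.
  by rewrite mulf_eq0 (negPf (degree_neq0 k)) orbF => /eqP.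
apply/rowP => j; rewrite !mxE mulrA.
have -> : a * coef j x = coef j (b i * x) by rewrite xa linearZ.
rewrite coord_mul mulr_suml.
apply: eq_bigr => k _; rewrite !mxE -!mulrA; congr (_ * _).
by rewrite mulrC coord_mul_adjoint dualK.
Qed.

(** * The Perron-Frobenius argument for the degrees *)

Lemma sqrt_degree_neq0 i : sqrtC (delta i) != 0.
Proof. by rewrite sqrtC_eq0 degree_neq0. Qed.

(* The matrix of the multiplication by [b i] in the basis of the
   [b j / sqrt (delta j)], orthonormal for the form [coef1 (x * star y)]. *)
Definition normalized_mx i : 'M[C]_r.+1 :=
  \matrix_(j, k) (sqrtC (delta k) * coef k (b i * b j) / sqrtC (delta j)).

Definition normalized_row x : 'rV[C]_r.+1 := \row_j (coef j x * sqrtC (delta j)).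

Lemma normalized_row_inj : injective normalized_row.
Proof.
move=> x y xy; apply: coord_ext => k; have /rowP/(_ k) := xy; rewrite !mxE.
exact: (mulIf (sqrt_degree_neq0 k)).
Qed.

Lemma normalized_row_surj u : exists x, normalized_row x = u.
Proof.
exists (\sum_k (u 0 k / sqrtC (delta k)) *: b k); apply/rowP => k.
by rewrite !mxE coord_lincomb divfK ?sqrt_degree_neq0.
Qed.

Lemma normalized_rowZ a x : normalized_row (a *: x) = a *: normalized_row x.
Proof. by apply/rowP => k; rewrite !mxE linearZ /= mulrA. Qed.

Lemma normalized_row_mul i x : normalized_row x *m normalized_mx i = normalized_row (b i * x).
Proof.
apply/rowP => k; rewrite !mxE coord_mul mulr_suml; apply: eq_bigr => j _; rewrite !mxE.
by have := sqrt_degree_neq0 j; move: (sqrtC _) => s s_neq0; field.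
Qed.

Local Open Scope sesquilinear_scope.

(** The conjugate transpose is the matrix of [dual i], and multiplications commute. *)
Lemma normalized_mx_normal i : normalized_mx i \is normalmx.
Proof.
have conj_sqrt k : (sqrtC (delta k))^* = sqrtC (delta k).
  by rewrite conj_Creal // ger0_real // sqrtC_ge0 ltW ?degree_gt0.
have -> : (normalized_mx i \is normalmx) =
    (normalized_mx i *m normalized_mx (dual i) == normalized_mx (dual i) *m normalized_mx i).
  rewrite qualifE /=; suff -> : (normalized_mx i)^t* = normalized_mx (dual i) by [].
  apply/matrixP => j k; rewrite !mxE !rmorphM fmorphV /=. rewrite !conj_sqrt.
  have [n Dn] := ita_nat itaB i k j; rewrite Dn conjC_nat -Dn.
  have [dj dk] := (sqrt_degree_neq0 j, sqrt_degree_neq0 k).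
  have := coord_mul_adjoint i k j; rewrite -[in LHS](sqrtCK (delta j)) -[in RHS](sqrtCK (delta k)).
  move: dj dk; set s := sqrtC (delta j); set t := sqrtC (delta k) => s0 t0 E.
  set p := coef j _ in E *; set p' := coef k _ in E *.
  transitivity (p * s ^+ 2 / (s * t)); first by field; rewrite s0 t0.
  by rewrite E; field; rewrite s0 t0.
apply/eqP/row_matrixP => j; rewrite !rowE.
have [x <-] := normalized_row_surj (delta_mx 0 j).
by rewrite !mulmxA !normalized_row_mul !mulrA [b i * _]mulC.
Qed.

(** For the vector [w] of absolute values, the triangle inequality gives
    [delta i * coef k w <= coef k (b i * w)] for all [k]. Pairing with [w] yields the inequality
    that [normal_dominant_eigenvector] turns into an equality. *)
Lemma nonneg_degree_eigenvector i :
  exists x, [/\ forall k, 0 <= coef k x, x != 0 & b i * x = delta i *: x].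
Proof.
have [dual_ev dual_max] := sita_degree sitaB (dual i).
have /eigenvalue_regular_dual[x x_neq0] := dual_ev; rewrite degree_dual => xd.
pose w := \sum_k `|coef k x| *: b k.
have w_coef k : coef k w = `|coef k x| by exact: coord_lincomb.
exists w; split=> [k||]; first by rewrite w_coef.
  apply: contraNneq x_neq0 => w0; apply/eqP/coord_ext => k; rewrite linear0.
  by apply/eqP; rewrite -normr_eq0 -w_coef w0 linear0.
have d_ge0 j : 0 <= delta j by rewrite ltW ?degree_gt0.
apply: normalized_row_inj; rewrite -normalized_row_mul normalized_rowZ.
apply: normal_dominant_eigenvector (normalized_mx_normal i) _ _ => [a|].
  move=> /eigenvalueP[v]; have [y <-] := normalized_row_surj v.
  rewrite normalized_row_mul -normalized_rowZ => /normalized_row_inj ya y_neq0.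
  rewrite -degree_dual; apply: dual_max; apply/eigenvalue_regular_dual; exists y => //.
  by apply: contraNneq y_neq0 => ->; apply/eqP/rowP => k; rewrite !mxE linear0 mul0r.
rewrite normalized_row_mul !mxE mulr_sumr ler_sum // => k _.
have w_ge0 : 0 <= coef k w * sqrtC (delta k).
  by rewrite mulr_ge0 ?sqrtC_ge0 ?w_coef.
rewrite !mxE mulrA ler_wpM2r ?conj_Creal ?ger0_real // mulrA.
rewrite ler_wpM2r ?sqrtC_ge0 // w_coef -{1}(ger0_norm (d_ge0 i)) -normrM.
have -> : delta i * coef k x = coef k (b i * x) by rewrite xd linearZ.
rewrite !coord_mul; apply: le_trans (ler_norm_sum _ _ _) _.
by apply: ler_sum => j _; rewrite normrM w_coef (ger0_norm (coord_mul_ge0 _ _ _)).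
Qed.

(** All terms of the expanded product are nonnegative. The second part isolates the term [1 * 1],
    and serves to keep products of eigenvectors nonzero. *)
Lemma coord_mulr_ge0 x y : (forall k, 0 <= coef k x) -> (forall k, 0 <= coef k y) ->
  (forall k, 0 <= coef k (x * y)) /\ coef1 x * coef1 y <= coef1 (x * y).
Proof.
move=> x_ge0 y_ge0.
have Dxy k : coef k (x * y) = \sum_i \sum_j coef i x * (coef j y * coef k (b i * b j)).
  rewrite {1}(coord_decomp x) mulr_suml linear_sum; apply: eq_bigr => i _.
  by rewrite -scalerAl linearZ /= coord_mul mulr_sumr.
have term_ge0 k i j : 0 <= coef i x * (coef j y * coef k (b i * b j)).
  by rewrite !mulr_ge0 ?coord_mul_ge0.
split=> [k|]; first by rewrite Dxy !sumr_ge0 // => i _; rewrite sumr_ge0.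
rewrite /Defs.coef1 Dxy (bigD1 ord0) //= (bigD1 ord0) //= -addrA.
rewrite (ita_one itaB) mulr1 -(ita_one itaB) coord_tnth eqxx mulr1 lerDl.
by rewrite addr_ge0 ?sumr_ge0 // => i _; rewrite sumr_ge0.
Qed.

Lemma common_degree_eigenvector :
  exists2 x, coef1 x != 0 & forall i, b i * x = delta i *: x.
Proof.
suff [x [_ x0 xP]] : exists x, [/\ forall k, 0 <= coef k x, 0 < coef1 x
    & forall i, i \in enum 'I_r.+1 -> b i * x = delta i *: x].
  by exists x; [exact: lt0r_neq0|move=> i; apply: xP; rewrite mem_enum].
elim: (enum _) => [|i s [x [x_ge0 x_gt0 xP]]].
  exists 1; rewrite -(ita_one itaB) /Defs.coef1 coord_tnth eqxx; split=> // k.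
  by rewrite coord_tnth ler0n.
have [y [y_ge0 y_neq0 yP]] := nonneg_degree_eigenvector i.
have [k yk_neq0] : exists k, coef k y != 0.
  apply/existsP; apply: contraNT y_neq0 => /existsPn y0; apply/eqP/coord_ext => k.
  by rewrite linear0; apply/eqP; exact: negbNE (y0 k).
(* This moves a nonzero coordinate of [y] to the coordinate of 1, while [z] stays an eigenvector of
   [b i]. *)
pose z := y * star (b k).
have z_gt0 : 0 < coef1 z.
  by rewrite coef1_star_tnth mulr_gt0 ?degree_gt0 // lt0r yk_neq0 y_ge0.
have [z_ge0 _] : (forall k, 0 <= coef k z) /\ coef1 y * coef1 (b (dual k)) <= coef1 z.
  rewrite /z -tnth_dual; apply: coord_mulr_ge0 => // l.
  by rewrite coord_tnth ler0n.
have [zx_ge0 zx_gt0] := coord_mulr_ge0 z_ge0 x_ge0.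
exists (z * x); split=> // [|j].
  by apply: lt_le_trans zx_gt0; rewrite mulr_gt0.
rewrite in_cons => /orP[/eqP->|js]; first by rewrite !mulrA yP !scalerAl.
by rewrite mulrA [b j * z]mulC -mulrA xP // scalerAr.
Qed.

Lemma degree_eigenvector i : b i * (\sum_j b j) = delta i *: \sum_j b j.
Proof.
have [x x0 xP] := common_degree_eigenvector.
(* [coef1 (x * star (b j))] equals both [coef j x * delta j] and [delta j * coef1 x]. *)
have Dx : x = coef1 x *: \sum_j b j.
  rewrite {1}(coord_decomp x) scaler_sumr; apply: eq_bigr => j _; congr (_ *: _).
  apply: (mulIf (degree_neq0 j)); rewrite -coef1_star_tnth mulC -tnth_dual xP.
  by rewrite /Defs.coef1 linearZ /= degree_dual mulrC.
by apply: (scalerI x0); rewrite scalerAr -Dx xP scalerA mulrC -scalerA -Dx.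
Qed.

(** * Eigenvalues as character values *)

Lemma regular_mx_comm i j : comm_mx (regular_mx B i) (regular_mx B j).
Proof.
have DM i1 i2 k l : (regular_mx B i1 *m regular_mx B i2) k l = coef k (b i1 * (b i2 * b l)).
  rewrite !mxE coord_mul; apply: eq_bigr => m _; rewrite !mxE; exact: mulrC.
by apply/matrixP => k l; rewrite !DM !mulrA [b j * b i]mulC.
Qed.

(** Commuting matrices have a common eigenvector [v] inside the [a]-eigenspace of [M i]. The
    functional [f] with values [v 0 k] on the basis satisfies [f (b j * x) = c * f x] with [c]
    depending on [j] only, so [f / f 1] is multiplicative. *)
Lemma eigenvalue_character i a :
  eigenvalue (regular_mx B i) a -> exists chi : {lrmorphism A -> C | *%R}, chi (b i) = a.
Proof.
set M := regular_mx B => ev_a; pose E := eigenspace (M i) a.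
have [v v_neq0 [vi vM]] : exists2 v : 'rV_r.+1, v != 0 &
    v *m M i = a *: v /\ forall j, exists c, v *m M j = c *: v.
  have E_gt0 : (0 < \rank E)%N by rewrite lt0n mxrank_eq0.
  have stableE j : stablemx E (M j) by rewrite comm_mx_stable_eigenspace //; exact: regular_mx_comm.
  have [|w w_neq0 /allP wP] := @common_eigenvector C _
      [seq restrictmx E (M j) | j <- enum 'I_r.+1] E_gt0.
    move=> _ _ /mapP[j1 _ ->] /mapP[j2 _ ->].
    by rewrite /comm_mx -!conjmxM ?inE ?stablemx_row_base // (regular_mx_comm j1 j2).
  exists (w *m row_base E); first by rewrite mulmx_free_eq0 ?row_base_free.
  split=> [|j]; first by apply/eigenspaceP; rewrite mulmx_sub // eq_row_base.
  have : stablemx (w *m row_base E) (M j).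
    rewrite -stablemx_restrict // wP //; apply/mapP; exists j => //.
    by rewrite mem_enum.
  by move=> /eigenvectorP[c /eigenspaceP Dc]; exists c.
pose f x := \sum_k v 0 k * coef k x.
have f_linear : linear_for *%R f.
  move=> c x y; rewrite /f mulr_sumr -big_split /=; apply: eq_bigr => k _.
  by rewrite linearP /= mulrDr mulrCA.
have f_sum (I : finType) (c : I -> C) (x : I -> A) :
    f (\sum_j c j *: x j) = \sum_j c j * f (x j).
  have f0 : f 0 = 0 by apply: big1 => k _; rewrite linear0 mulr0.
  elim/big_ind2: _ => // [x1 y1 x2 y2 <- <-|j _].
    by have := f_linear 1 y1 y2; rewrite scale1r mul1r.
  by have := f_linear (c j) (x j) 0; rewrite f0 !addr0.
have f_mul j c : v *m M j = c *: v -> forall x, f (b j * x) = c * f x.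
  move=> vc x; rewrite {1}(coord_decomp x) mulr_sumr.
  under eq_bigr do rewrite -scalerAr.
  rewrite f_sum /f mulr_sumr; apply: eq_bigr => l _; rewrite mulrA mulrC; congr (_ * _).
  by have /rowP/(_ l) := vc; rewrite !mxE => <-; apply: eq_bigr => k _; rewrite !mxE.
have f_b j : f (b j) = v 0 j.
  rewrite /f (bigD1 j) //= coord_tnth eqxx mulr1 big1 ?addr0 // => k kj.
  by rewrite coord_tnth eq_sym (negPf kj) mulr0.
have f1_neq0 : f 1 != 0.
  apply: contraNneq v_neq0 => f10; apply/eqP/rowP => j; rewrite mxE -f_b.
  by have [c vc] := vM j; rewrite -[b j]mulr1 (f_mul _ _ vc) f10 mulr0.
pose chi x := f x / f 1.
have chi_linear : linear_for *%R chi.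
  by move=> c x y; rewrite /chi f_linear mulrDl mulrA.
have chi_monoid : monoid_morphism chi.
  split=> [|x y]; first by rewrite /chi divff.
  suff fM : f (x * y) = f x * f y / f 1.
    by rewrite /chi fM !mulrA; congr (_ / _); rewrite mulrAC.
  rewrite {1 2}(coord_decomp x) mulr_suml; under eq_bigr do rewrite -scalerAl.
  rewrite !f_sum mulrAC mulr_suml mulr_suml; apply: eq_bigr => j _.
  have [c vc] := vM j; rewrite (f_mul _ _ vc) -[b j in RHS]mulr1 (f_mul _ _ vc).
  by rewrite -!mulrA mulVKf.
pose chi_lin := GRing.isLinear.Build C A C *%R chi chi_linear.
pose chi_mor := GRing.isMonoidMorphism.Build A C chi chi_monoid.
pose chi_lr : {lrmorphism A -> C | *%R} := HB.pack chi chi_lin chi_mor.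
by exists chi_lr; rewrite /= /chi -[b i]mulr1 (f_mul _ _ vi) mulfK.
Qed.

Lemma coord_star k x : coef k (star x) = (coef (dual k) x)^*.
Proof.
rewrite star_decomp linear_sum (bigD1 (dual k)) //= big1 ?addr0 => [|j jk].
  by rewrite linearZ /= -tnth_dual dualK coord_tnth eqxx mulr1.
rewrite linearZ /= -tnth_dual coord_tnth (can2_eq dualK dualK) (negPf jk).
by rewrite mulr0.
Qed.

(** * Rational coordinates and quadratic character values *)

Definition rat_coord x := forall k, is_rat (coef k x).

Lemma rat_coord_tnth i : rat_coord (b i).
Proof. by move=> k; rewrite coord_tnth; apply: is_rat_nat. Qed.

Lemma rat_coordD x y : rat_coord x -> rat_coord y -> rat_coord (x + y).
Proof. by move=> rx ry k; rewrite linearD; exact: is_ratD (rx k) (ry k). Qed.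

Lemma rat_coordB x y : rat_coord x -> rat_coord y -> rat_coord (x - y).
Proof. by move=> rx ry k; rewrite linearB; exact: is_ratB (rx k) (ry k). Qed.

Lemma rat_coordM x y : rat_coord x -> rat_coord y -> rat_coord (x * y).
Proof.
move=> rx ry k; rewrite (coord_decomp x) mulr_suml linear_sum; apply: is_rat_sum => i.
rewrite -scalerAl linearZ /= coord_mul; apply: is_ratM (rx i) _.
apply: is_rat_sum => j; apply: is_ratM (ry j) _.
by have [n ->] := ita_nat itaB i j k; apply: is_rat_nat.
Qed.

(** The square of [chi (b j)] is a rational combination of the [chi (b k)], hence affine in
    [chi (b j)]. *)
Lemma rat_quadratic_character (chi : {lrmorphism A -> C | *%R}) j :
    (forall k, rat_affine (chi (b j)) (chi (b k))) ->
  forall k, rat_quadratic (chi (b k)).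
Proof.
move=> affP k; apply: rat_quadratic_rat_affine (affP k).
rewrite expr2 -[_ * _]rmorphM (coord_decomp (b j * b j)) raddf_sum /=.
apply: (big_ind (rat_affine (chi (b j)))) => [||i _].
- apply: rat_affine_rat; exact: (is_rat_nat C 0).
- exact: rat_affineD.
- by rewrite linearZ /=; apply: rat_affineZ (affP i); apply: rat_coordM; apply: rat_coord_tnth.
Qed.

(** The roots of the product of all characteristic polynomials list the finitely many eigenvalues,
    which then share one cyclotomic field. *)
Lemma rat_quadratic_cyclotomic_eigenvalues :
    (forall i a, eigenvalue (regular_mx B i) a -> rat_quadratic a) ->
  cyclotomic_eigenvalues B.
Proof.
move=> quadP; pose p := \prod_i char_poly (regular_mx B i).
have p_neq0 : p != 0 by apply/prodf_neq0 => i _; rewrite monic_neq0 ?char_poly_monic.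
have [s Dp] := closed_field_poly_normal p.
have memP a : (a \in s) = root p a.
  by rewrite Dp rootZ ?root_prod_XsubC // lead_coef_eq0.
have [a|N [z [prim_z zP]]] := @seq_eventually_cyclotomic _ s.
  rewrite memP /root horner_prod => /prodf_eq0[i _ ia].
  apply/rat_quadratic_eventually_cyclotomic/(quadP i).
  by rewrite eigenvalue_root_char.
exists N, z; split=> // i a; rewrite eigenvalue_root_char => ia.
apply: zP; rewrite memP /root horner_prod; apply/prodf_eq0; by exists i.
Qed.

End CommutativeSITA.

(** * Rank 5 with one asymmetric pair *)

Section OneAsymmetricPair.
Variables (C : numClosedFieldType) (A : falgType C) (star : A -> A) (b1 b2 b3 : A).
Variable delta : 'I_5 -> C.
Local Notation b4 := (star b3).
Local Notation B := [tuple 1; b1; b2; b3; b4].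
Hypotheses (star_b1 : star b1 = b1) (star_b2 : star b2 = b2).
Hypotheses (sitaB : SITA star B delta) (mulC : commutative (@GRing.mul A)).

Local Notation coef := (coord B).
Let invB : algebra_involution star := ita_involution (sita_ita sitaB).
Let o1 : 'I_5 := @Ordinal 5 1 isT.
Let o2 : 'I_5 := @Ordinal 5 2 isT.
Let o3 : 'I_5 := @Ordinal 5 3 isT.
Let o4 : 'I_5 := @Ordinal 5 4 isT.
Let t := b3 - b4.

Let decomp5 x : x = coef ord0 x *: 1 + (coef o1 x *: b1 + (coef o2 x *: b2 +
  (coef o3 x *: b3 + coef o4 x *: b4))).
Proof.
rewrite {1}(coord_decomp sitaB x) !big_ord_recl big_ord0 addr0.
by do 4?[congr (_ + _)]; congr (coord B _ _ *: _); apply: val_inj.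
Qed.

Let dual_o0 : dual star B ord0 = ord0.
Proof. by apply: (tnth_basis_inj sitaB); rewrite (tnth_dual sitaB) /= (star1 sitaB). Qed.
Let dual_o1 : dual star B o1 = o1.
Proof. by apply: (tnth_basis_inj sitaB); rewrite (tnth_dual sitaB). Qed.
Let dual_o2 : dual star B o2 = o2.
Proof. by apply: (tnth_basis_inj sitaB); rewrite (tnth_dual sitaB). Qed.
Let dual_o3 : dual star B o3 = o4.
Proof. by apply: (tnth_basis_inj sitaB); rewrite (tnth_dual sitaB). Qed.

Lemma star_asym : star t = - t.
Proof. by rewrite (starB sitaB) (starK invB) opprB. Qed.

(** On rational coordinates [star] acts by the permutation [dual]: the coordinates it fixes must
    vanish, and the two it swaps are opposite. *)
Lemma antisymmetric_rat_coord x : rat_coord B x -> star x = - x -> x = coef o3 x *: t.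
Proof.
move=> rx sx; have co k : coef (dual star B k) x = - coef k x.
  by rewrite -(is_rat_conj (rx _)) -(coord_star sitaB) sx linearN.
have co0 k : dual star B k = k -> coef k x = 0.
  by move=> kk; apply/eqP; rewrite -eqNr -co kk.
rewrite {1}(decomp5 x) (co0 _ dual_o0) (co0 _ dual_o1) (co0 _ dual_o2) !scale0r !add0r -dual_o3 co.
by rewrite /t scalerBr scaleNr.
Qed.

Lemma symmetric_rat_coord x : rat_coord B x -> star x = x ->
  x = coef ord0 x *: 1 + (coef o1 x *: b1 + (coef o2 x *: b2 + coef o3 x *: (b3 + b4))).
Proof.
move=> rx sx; rewrite {1}(decomp5 x) scalerDr; do 4?[congr (_ + _)].
by congr (_ *: _); rewrite -(is_rat_conj (rx o4)) -dual_o3 -(coord_star sitaB) sx.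
Qed.

Let rat_t : rat_coord B t.
Proof.
exact: rat_coordB (rat_coord_tnth sitaB o3) (rat_coord_tnth sitaB o4).
Qed.

Lemma asym_mul_symmetric x : rat_coord B x -> star x = x ->
  exists2 q, is_rat q & t * x = q *: t.
Proof.
move=> rx sx; have rtx : rat_coord B (t * x) by exact: (rat_coordM sitaB).
exists (coef o3 (t * x)) => //; apply: antisymmetric_rat_coord => //.
by rewrite (starM invB) sx star_asym mulrN mulC.
Qed.

Lemma character_rat_quadratic (chi : {lrmorphism A -> C | *%R}) i :
  rat_quadratic (chi (tnth B i)).
Proof.
have rb k : rat_coord B (tnth B k) := rat_coord_tnth sitaB k.
have rat2V : is_rat (2^-1 : C) by exact/is_ratV/(is_rat_nat C 2).
have rat1 : is_rat (1 : C) := is_rat_nat C 1.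
pose s := t * t; have rs : rat_coord B s by exact: (rat_coordM sitaB).
have Ds : s = coef ord0 s *: 1 + (coef o1 s *: b1 + (coef o2 s *: b2 + coef o3 s *: (b3 + b4))).
  by apply: symmetric_rat_coord => //; rewrite (starM invB) star_asym mulrNN.
move: Ds (rs ord0) (rs o1) (rs o2) (rs o3).
set q0 := coef ord0 s; set q1 := coef o1 s; set q2 := coef o2 s; set q3 := coef o3 s.
move=> Ds rq0 rq1 rq2 rq3.
have chi_s : chi t ^+ 2 = q0 + q1 * chi b1 + q2 * chi b2 + q3 * (chi b3 + chi b4).
  by rewrite expr2 -rmorphM /= -/s Ds !rmorphD /= !linearZ /= rmorph1 mulr1 !rmorphD !addrA.
have chi_t : chi t = chi b3 - chi b4 by rewrite rmorphB.
have [t0|t_neq0] := eqVneq (chi t) 0; last first.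
  (* Case [chi t <> 0]: cancel [chi t] in [chi t * chi x = q * chi t]. *)
  have rat_sym x : rat_coord B x -> star x = x -> is_rat (chi x).
    move=> rx sx; have [q rq Dq] := asym_mul_symmetric rx sx.
    by have := congr1 chi Dq; rewrite rmorphM linearZ mulrC => /(mulIf t_neq0) ->.
  have rX := rat_sym b1 (rb o1) star_b1; have rY := rat_sym b2 (rb o2) star_b2.
  have rS : is_rat (chi b3 + chi b4).
    rewrite -rmorphD; apply: rat_sym; first exact: (rat_coordD (rb o3) (rb o4)).
    by rewrite (starD invB) (starK invB) addrC.
  have quad_t : rat_quadratic (chi t).
    exists 0, (chi t ^+ 2); split; [exact: (is_rat_nat C 0)| |by rewrite mul0r add0r].
    by rewrite chi_s; do 3?[apply: is_ratD => //]; apply: is_ratM.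
  have quad_half e : is_rat e -> rat_quadratic (2^-1 * (chi b3 + chi b4) + e * chi t).
    by move=> re; apply: rat_quadratic_affine => //; apply: is_ratM.
  case: i => [[|[|[|[|[|//]]]]] ?]; rewrite /tnth /=.
  - by rewrite rmorph1; apply: rat_quadratic_rat.
  - exact: rat_quadratic_rat.
  - exact: rat_quadratic_rat.
  - rewrite [chi b3](_ : _ = 2^-1 * (chi b3 + chi b4) + 2^-1 * chi t); last by rewrite chi_t; field.
    exact: quad_half.
  - rewrite [chi b4](_ : _ = 2^-1 * (chi b3 + chi b4) + (- 2^-1) * chi t).
      by apply: quad_half; apply: is_ratN.
    by rewrite chi_t; field.
have D4 : chi b4 = chi b3 by apply/esym/eqP; rewrite -subr_eq0 -chi_t t0.
pose J := \sum_j tnth B j.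
have JE k : tnth B k * J = delta k *: J := degree_eigenvector sitaB mulC k.
have chi_J : chi J = 1 + chi b1 + chi b2 + 2 * chi b3.
  rewrite /J !big_ord_recl big_ord0 addr0 !rmorphD /= rmorph1 D4; ring.
have [J0|J_neq0] := eqVneq (chi J) 0; last first.
  (* Applying [chi] to [b i * J = delta i *: J] identifies [chi] with the degree character, whose
     values are natural numbers. *)
  apply: rat_quadratic_rat; have [n Dn] := degree_nat sitaB i.
  have := congr1 chi (JE i); rewrite rmorphM linearZ => /(mulIf J_neq0) ->.
  by rewrite Dn; apply: is_rat_nat.
have J_nz : J != 0.
  apply/eqP => /(congr1 (coef ord0)); rewrite linear0 /J linear_sum (bigD1 ord0) //=.
  rewrite (coord_tnth sitaB) big1 ?addr0 => [/eqP|j j0]; first by rewrite oner_eq0.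
  by rewrite (coord_tnth sitaB) (negPf j0).
have d4 : delta o4 = delta o3 by rewrite -dual_o3 (degree_dual sitaB).
(* The degree of [s]: it is 0 because [b3] and [b4] have equal degrees, so that [t * J = 0]. *)
have degree_s : q0 + q1 * delta o1 + q2 * delta o2 + 2 * q3 * delta o3 = 0.
  have sJ : s * J = 0.
    rewrite /s -mulrA; suff -> : t * J = 0 by rewrite mulr0.
    by rewrite mulrBl (JE o3) (JE o4) d4 subrr.
  apply/eqP; suff : (q0 + q1 * delta o1 + q2 * delta o2 + 2 * q3 * delta o3) *: J == 0.
    by rewrite scaler_eq0 (negPf J_nz) orbF.
  have DsJ : s * J = q0 *: J + (q1 *: (delta o1 *: J) + (q2 *: (delta o2 *: J) +
      q3 *: (delta o3 *: J + delta o3 *: J))).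
    by rewrite {1}Ds !mulrDl -!scalerAl mulrDl mul1r (JE o1) (JE o2) (JE o3) (JE o4) d4.
  rewrite -sJ DsJ -[X in q3 *: X]scalerDl !scalerA -!scalerDl; apply/eqP; congr (_ *: _).
  by ring.
have q0_neq0 : q0 != 0.
  have coef_t k : coef k t = (o3 == k)%:R - (o4 == k)%:R.
    by rewrite linearB -!(coord_tnth sitaB).
  (* Write [t * t = t * star b4 - t * b4] and read off the coordinates -1 and 1 of [t] at [b4] and
     [b3]. *)
  have -> : q0 = - (delta o4 + delta o3).
    rewrite /q0 /s {2}/t mulrBr linearB.
    have /= := coef1_star_tnth sitaB t o3; rewrite /Defs.coef1 /= => ->.
    have := coef1_star_tnth sitaB t o4; rewrite /Defs.coef1 /= (starK invB) => ->.
    rewrite !coef_t /=; ring.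
  by rewrite oppr_eq0 lt0r_neq0 // addr_gt0 ?(degree_gt0 sitaB).
have {chi_s}chi_s : q0 + q1 * chi b1 + q2 * chi b2 + q3 * (2 * chi b3) = 0.
  by rewrite mulr_natl mulr2n -{2}D4 -chi_s t0 expr0n.
have chi3 : chi b3 = - 2^-1 * (1 + chi b1 + chi b2).
  have -> : 1 + chi b1 + chi b2 = chi J - 2 * chi b3 by rewrite chi_J; ring.
  by rewrite J0; field.
have aff_all j : (forall k, k \in [:: o1; o2] -> rat_affine (chi (tnth B j)) (chi (tnth B k))) ->
    forall k, rat_quadratic (chi (tnth B k)).
  move=> aff; have aff1 := aff o1 isT; have aff2 := aff o2 isT.
  have aff0 : rat_affine (chi (tnth B j)) 1 by exact: rat_affine_rat.
  have aff3 : rat_affine (chi (tnth B j)) (chi b3).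
    rewrite chi3; apply: rat_affineZ; first exact: is_ratN.
    by apply: rat_affineD => //; apply: rat_affineD.
  apply: (rat_quadratic_character sitaB (j := j)); case=> [[|[|[|[|[|//]]]]] ?];
    rewrite [X in chi X]/tnth /= ?D4 ?rmorph1 //.
(* Eliminate [chi b3] between [chi s = 0] and [chi J = 0]. *)
have relation : (q0 - q3) + (q1 - q3) * chi b1 + (q2 - q3) * chi b2 = 0.
  by rewrite -[RHS]chi_s chi3; field.
(* A nonzero coefficient at [chi b2] or [chi b1] makes that value affine in the other one. *)
have [q23|q23] := eqVneq q2 q3; last first.
  apply: (aff_all o1) => k; rewrite !inE => /orP[/eqP->|/eqP->]; first exact: rat_affine_gen.
  by apply: rat_affine_relation relation; rewrite ?subr_eq0 //; apply: is_ratB.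
have [q13|q13] := eqVneq q1 q3; last first.
  apply: (aff_all o2) => k; rewrite !inE => /orP[/eqP->|/eqP->]; last exact: rat_affine_gen.
  rewrite addrAC in relation.
  by apply: rat_affine_relation relation; rewrite ?subr_eq0 //; apply: is_ratB.
(* If both coefficients vanish, then also [q0 = q3] and [s = q0 *: J]. Its degree is [q0] times the
   order, which is nonzero, against [degree_s]. *)
have /eqP : q0 * (1 + (delta o1 + delta o2 + 2 * delta o3)) = 0.
  have /eqP := relation; rewrite q13 q23 !subrr !mul0r !addr0 subr_eq0 => /eqP q03.
  by rewrite -degree_s q13 q23 q03; ring.
have d_gt0 := degree_gt0 sitaB; rewrite mulf_eq0 (negPf q0_neq0) /= gt_eqF //.
by rewrite ltr_wpDl ?ler01 // !addr_gt0 // mulr_gt0 ?ltr0n.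
Qed.

End OneAsymmetricPair.

Theorem theorem4p2 (R : realType) (A : falgType R[i]) (star : A -> A)
    (b1 b2 b3 : A) (h1 : star b1 = b1) (h2 : star b2 = b2)
    (h3 : star b3 <> b3)
    (hB : SITAwIM star [tuple 1; b1; b2; b3; star b3]) :
  cyclotomic_eigenvalues [tuple 1; b1; b2; b3; star b3].
Proof.
case: hB => delta [sitaB mulC _].
apply: rat_quadratic_cyclotomic_eigenvalues => i a.
move=> /(eigenvalue_character sitaB mulC)[chi <-].
exact: (character_rat_quadratic h1 h2 sitaB mulC).
Qed.
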